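(* $$\sum_{k\ge0}F_{\{132,(k+1)k\cdots21\}}(x,q,z)\,p^k=\frac{2(1+xz(p-1))}{(1-p)\bigl[1+(1+q-2x)z-qz^2(p-1)^2+\sqrt{f_1(q,z)}\bigr]},$$ where $f_1(q,z)=1-2(1+q)z+[(1-q)^2-2q(p-1)(p+3)]z^2-2q(1+q)(p-1)^2z^3+q^2(p-1)^4z^4$.
   Context: For permutations $\pi=\pi_1\cdots\pi_n\in\mathfrak{S}_n$ and $\sigma\in\mathfrak{S}_m$, $\pi$ contains $\sigma$ if there are indices $i_1<\dots<i_m$ such that $\pi_{i_1}\cdots\pi_{i_m}$ is in the same relative order as $\sigma$; otherwise $\pi$ avoids $\sigma$. For a set $\Sigma$ of patterns, $\mathfrak{S}_n(\Sigma)$ is the set of permutations in $\mathfrak{S}_n$ avoiding every pattern in $\Sigma$; $(k+1)k\cdots21$ denotes the decreasing pattern of length $k+1$. $\mathrm{fp}(\pi)=|\{i:\pi_i=i\}|$, $\mathrm{exc}(\pi)=|\{i:\pi_i>i\}|$, and $F_\Sigma(x,q,z)=\sum_{n\ge0}\sum_{\pi\in\mathfrak{S}_n(\Sigma)}x^{\mathrm{fp}(\pi)}q^{\mathrm{exc}(\pi)}z^n$ ($\mathfrak{S}_0$ contains only the empty permutation). Identities are in formal power series in $z$ and $p$. *)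

(* Defs.v *)
From HB Require Import structures.
From mathcomp Require Import all_boot all_order all_algebra all_fingroup.
From mathcomp Require Import boolp.

Set Implicit Arguments.
Unset Strict Implicit.
Unset Printing Implicit Defensive.

Import GRing.Theory.
Local Open Scope ring_scope.

Record fps (R : Type) : Type := Fps { coefs : nat -> R }.

Notation "{ 'fps' R }" := (fps R)
  (at level 0, R at level 200, format "{ 'fps'  R }") : type_scope.
Notation "\fps_ n E" := (Fps (fun n : nat => E))
  (at level 36, n name, E at level 36, format "\fps_ n  E") : ring_scope.

Lemma fpsP (R : Type) (f g : {fps R}) : coefs f =1 coefs g -> f = g.
Proof. by case: f g => [f] [g] /= /funext ->. Qed.

HB.instance Definition _ (R : Type) := gen_eqMixin {fps R}.
HB.instance Definition _ (R : Type) := gen_choiceMixin {fps R}.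

(** [crec step] is the sequence u with u n = step [:: u 0; ...; u n.-1]. *)
Section CourseOfValues.
Variables (R : Type) (x0 : R) (step : seq R -> R).

Definition crec (n : nat) : R :=
  nth x0 (iter n.+1 (fun s => rcons s (step s)) [::]) n.

Lemma crecE n : crec n = step (mkseq crec n).
Proof.
pose it k := iter k (fun s => rcons s (step s)) [::].
have sz k : size (it k) = k by elim: k => //= k IH; rewrite size_rcons IH.
have crec_it k : crec k = step (it k).
  by rewrite /crec -/(it k.+1) /= nth_rcons sz ltnn eqxx.
suff -> : mkseq crec n = it n by exact: crec_it.
by elim: n => //= n IH; rewrite mkseqS IH crec_it.
Qed.
End CourseOfValues.

Section FpsRing.
Variable R : comNzRingType.
Implicit Types f g h : {fps R}.

Definition fps_zero : {fps R} := \fps_n 0.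
Definition fps_opp f : {fps R} := \fps_n (- coefs f n).
Definition fps_add f g : {fps R} := \fps_n (coefs f n + coefs g n).
Definition fpsC (c : R) : {fps R} := \fps_n (if n == 0%N then c else 0).
Definition fpsX : {fps R} := \fps_n (n == 1%N)%:R.
Definition fps_mul f g : {fps R} :=
  \fps_n (\sum_(i < n.+1) coefs f i * coefs g (n - i)).

Fact fps_addA : associative fps_add.
Proof. by move=> f g h; apply: fpsP => n; exact: addrA. Qed.
Fact fps_addC : commutative fps_add.
Proof. by move=> f g; apply: fpsP => n; exact: addrC. Qed.
Fact fps_add0 : left_id fps_zero fps_add.
Proof. by move=> f; apply: fpsP => n; exact: add0r. Qed.
Fact fps_addN : left_inverse fps_zero fps_opp fps_add.
Proof. by move=> f; apply: fpsP => n; exact: addNr. Qed.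

HB.instance Definition _ :=
  GRing.isZmodule.Build {fps R} fps_addA fps_addC fps_add0 fps_addN.

Let tr n f : {poly R} := \poly_(i < n.+1) coefs f i.

Let coef_tr n f i : (i <= n)%N -> (tr n f)`_i = coefs f i.
Proof. by move=> le_in; rewrite coef_poly ltnS le_in. Qed.

Let coef_mul_tr m n f g : (n <= m)%N ->
  coefs (fps_mul f g) n = (tr m f * tr m g)`_n.
Proof.
move=> le_nm; rewrite coefM; apply: eq_bigr => i _.
by rewrite !coef_tr //; apply: leq_trans le_nm; rewrite ?leq_subr // -ltnS.
Qed.

Fact fps_mulC : commutative fps_mul.
Proof. by move=> f g; apply: fpsP => n; rewrite !(@coef_mul_tr n) // mulrC. Qed.

Fact fps_mulA : associative fps_mul.
Proof.
move=> f g h; apply: fpsP => n.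
transitivity (tr n f * (tr n g * tr n h))`_n.
  rewrite coefM; apply: eq_bigr => i _.
  by rewrite coef_tr -1?ltnS // (@coef_mul_tr n) ?leq_subr.
rewrite mulrA coefM; apply: eq_bigr => i _.
by rewrite coef_tr ?leq_subr // (@coef_mul_tr n) // -ltnS.
Qed.

Fact fps_mul1 : left_id (fpsC 1) fps_mul.
Proof.
move=> f; apply: fpsP => n /=; rewrite big_ord_recl /= mul1r subn0.
by rewrite big1 ?addr0 // => i _; rewrite mul0r.
Qed.

Fact fps_mulDl : left_distributive fps_mul fps_add.
Proof.
move=> f g h; apply: fpsP => n /=; rewrite -big_split.
by apply: eq_bigr => i _; rewrite mulrDl.
Qed.

Fact fps_1neq0 : fpsC 1 != fps_zero.
Proof. by apply/eqP => /(congr1 (fun f => coefs f 0)) /eqP; rewrite oner_eq0. Qed.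

HB.instance Definition _ := GRing.Zmodule_isComNzRing.Build {fps R}
  fps_mulA fps_mulC fps_mul1 fps_mulDl fps_1neq0.

Lemma coefs0 n : coefs (0 : {fps R}) n = 0. Proof. by []. Qed.
Lemma coefs1 n : coefs (1 : {fps R}) n = (n == 0%N)%:R.
Proof. by rewrite /=; case: eqP. Qed.
Lemma coefsN f n : coefs (- f) n = - coefs f n. Proof. by []. Qed.
Lemma coefsD f g n : coefs (f + g) n = coefs f n + coefs g n. Proof. by []. Qed.
Lemma coefsM f g n :
  coefs (f * g) n = \sum_(i < n.+1) coefs f i * coefs g (n - i).
Proof. by []. Qed.
Lemma coefs0M f g : coefs (f * g) 0 = coefs f 0 * coefs g 0.
Proof. by rewrite coefsM big_ord1. Qed.

Lemma coefsXn k n : coefs (fpsX ^+ k) n = (n == k)%:R.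
Proof.
elim: k n => [|k IH] n; first exact: coefs1.
rewrite exprS coefsM; case: n => [|n]; first by rewrite big_ord1 mul0r.
rewrite big_ord_recl mul0r add0r big_ord_recl mul1r subSS subn0 IH eqSS.
by rewrite big1 ?addr0 // => i _; rewrite mul0r.
Qed.

Lemma coefsCM c f n : coefs (fpsC c * f) n = c * coefs f n.
Proof.
rewrite coefsM big_ord_recl /= subn0 big1 ?addr0 // => i _.
by rewrite mul0r.
Qed.

(** [\fps_n c n] is the sum of the series of terms c n X^n. *)
Lemma fps_sum (c : nat -> R) N n : (n < N)%N ->
  coefs (\sum_(k < N) fpsC (c k) * fpsX ^+ k) n = coefs (\fps_k c k) n.
Proof.
move=> ltnN; transitivity (\sum_(k < N) c k * (n == k)%:R).
  elim/big_rec2: _ => // k a f _ <-.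
  by rewrite coefsD coefsCM coefsXn.
rewrite (bigD1 (Ordinal ltnN)) //= eqxx mulr1 big1 ?addr0 // => i ne_in.
by rewrite -val_eqE eq_sym /= in ne_in; rewrite (negbTE ne_in) mulr0.
Qed.

End FpsRing.

Arguments fpsX {R}.
Notation "c %:S" := (fpsC c) (at level 2, left associativity, format "c %:S")
  : ring_scope.

Section FpsUnitRing.
Variable R : comUnitRingType.
Implicit Types f g : {fps R}.

Definition fps_unit : {pred {fps R}} := fun f => coefs f 0 \is a GRing.unit.

Definition fps_inv_step f (s : seq R) : R :=
  ((size s == 0%N)%:R - \sum_(i < size s) s`_i * coefs f (size s - i))
    / coefs f 0.

Definition fps_inv f : {fps R} :=
  if fps_unit f then Fps (crec 0 (fps_inv_step f)) else f.

Fact fps_mulV : {in fps_unit, left_inverse 1 fps_inv *%R}.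
Proof.
move=> f; rewrite unfold_in => Uf; apply: fpsP => n.
rewrite coefsM coefs1 /fps_inv /fps_unit Uf /= big_ord_recr /= subnn crecE.
rewrite /fps_inv_step size_mkseq divrK //.
set a := \sum_(i < n) _; set b := \sum_(i < n) _.
suff -> : a = b by rewrite addrC subrK.
by apply: eq_bigr => i _; rewrite nth_mkseq.
Qed.

Fact fps_unitP f g : g * f = 1 -> fps_unit f.
Proof.
move=> /(congr1 (fun h => coefs h 0)); rewrite coefs0M coefs1 /= => gf1.
by apply/unitrP; exists (coefs g 0); rewrite [coefs f 0 * _]mulrC gf1.
Qed.

Fact fps_inv_out : {in [predC fps_unit], fps_inv =1 id}.
Proof. by move=> f; rewrite inE => /negbTE nUf; rewrite /fps_inv [fps_unit f]nUf. Qed.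

HB.instance Definition _ := GRing.ComNzRing_hasMulInverse.Build {fps R}
  fps_mulV fps_unitP fps_inv_out.

Lemma fps_unitE f : (f \is a GRing.unit) = (coefs f 0 \is a GRing.unit).
Proof. by []. Qed.

(** The square root of [f] with constant term [r], where r ^+ 2 = coefs f 0. *)
Definition fps_sqrt_step (r : R) f (s : seq R) : R :=
  if size s is n.+1 then
    (coefs f n.+1 - \sum_(1 <= i < n.+1) s`_i * s`_(n.+1 - i)) / (2 * r)
  else r.

Definition fps_sqrt_at (r : R) f : {fps R} := Fps (crec 0 (fps_sqrt_step r f)).

Lemma coefs0_sqrt_at r f : coefs (fps_sqrt_at r f) 0 = r.
Proof. by rewrite /= crecE. Qed.

Lemma sqr_fps_sqrt_at r f :
    2 * r \is a GRing.unit -> r ^+ 2 = coefs f 0 ->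
  fps_sqrt_at r f ^+ 2 = f.
Proof.
move=> U2r r2; apply: fpsP => -[|n].
  by rewrite expr2 coefs0M coefs0_sqrt_at -expr2.
rewrite expr2 coefsM -(big_mkord xpredT (fun i =>
  coefs (fps_sqrt_at r f) i * coefs (fps_sqrt_at r f) (n.+1 - i))).
rewrite big_nat_recr //= subnn big_nat_recl //= subn0.
set s := crec 0 _.
have -> : s 0%N = r by rewrite /s crecE.
set c := \sum_(0 <= i < n) _.
have sn : s n.+1 * (2 * r) = coefs f n.+1 - c.
  rewrite /s crecE /fps_sqrt_step size_mkseq divrK // big_add1 succnK; congr (_ - _).
  rewrite !big_mkord /c big_mkord; apply: eq_bigr => i _.
  by rewrite subSS !nth_mkseq ?ltnS ?leq_subr ?ltn_ord.
rewrite [r * _]mulrC addrAC -mulrDr.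
have -> : r + r = 2 * r by rewrite mulr_natl mulr2n.
by rewrite sn subrK.
Qed.

Lemma fps_sqrt_at_uniq r f g :
    2 * r \is a GRing.unit -> g ^+ 2 = f -> coefs g 0 = r ->
  g = fps_sqrt_at r f.
Proof.
move=> U2r g2 g0.
have r2 : r ^+ 2 = coefs f 0 by rewrite -g2 expr2 coefs0M g0.
have U : g + fps_sqrt_at r f \is a GRing.unit.
  by rewrite fps_unitE coefsD g0 coefs0_sqrt_at -mulr2n -mulr_natl.
apply/eqP; rewrite -subr_eq0 -(mulIr_eq0 _ (mulIr U)) -subr_sqr g2.
by rewrite sqr_fps_sqrt_at // subrr.
Qed.

End FpsUnitRing.

(** For a bivariate series whose constant term is 1: the square root whose
    constant term is 1. *)
Definition fps2_sqrt (R : comUnitRingType) (f : {fps {fps R}}) : {fps {fps R}} :=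
  fps_sqrt_at (fps_sqrt_at 1 (coefs f 0)) f.

Section Fps2Sqrt.
Variables (R : comUnitRingType) (f : {fps {fps R}}).
Hypothesis U2 : (2 : R) \is a GRing.unit.

Let natfpsE k : coefs (k%:R : {fps R}) 0 = k%:R.
Proof. by elim: k => // k IH; rewrite -addn1 !natrD coefsD IH. Qed.

Let U2sqrt : 2 * fps_sqrt_at 1 (coefs f 0) \is a GRing.unit.
Proof. by rewrite fps_unitE coefs0M coefs0_sqrt_at natfpsE mulr1. Qed.

Lemma sqr_fps2_sqrt : coefs (coefs f 0) 0 = 1 -> fps2_sqrt f ^+ 2 = f.
Proof.
by move=> f0; rewrite sqr_fps_sqrt_at ?sqr_fps_sqrt_at ?mulr1 ?expr1n.
Qed.

Lemma coefs00_fps2_sqrt : coefs (coefs (fps2_sqrt f) 0) 0 = 1.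
Proof. by rewrite !coefs0_sqrt_at. Qed.

Lemma fps2_sqrt_uniq g :
  g ^+ 2 = f -> coefs (coefs g 0) 0 = 1 -> g = fps2_sqrt f.
Proof.
move=> g2 g0; apply: fps_sqrt_at_uniq => //.
by apply: fps_sqrt_at_uniq; rewrite ?mulr1 // -g2 [in RHS]expr2 coefs0M -expr2.
Qed.
End Fps2Sqrt.

(** [pi : 'S_n] acts on {0, ..., n-1}: the value at position i + 1 is
    [pi i + 1], which leaves patterns, fixed points and excedances unchanged. *)
Definition contains n m (pi : 'S_n) (sigma : 'S_m) : bool :=
  [exists f : {ffun 'I_m -> 'I_n},
    [forall i : 'I_m, forall j : 'I_m, (i < j)%N ==> (f i < f j)%N] &&
    [forall i : 'I_m, forall j : 'I_m,
      (pi (f i) < pi (f j))%N == (sigma i < sigma j)%N]].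

Definition pattern : Type := {m : nat & 'S_m}.
Definition Pattern m (sigma : 'S_m) : pattern := Tagged (fun k => 'S_k) sigma.

Definition avoids n (pi : 'S_n) (sigma : pattern) : bool :=
  ~~ contains pi (tagged sigma).

Definition Sav n (Sigma : seq pattern) : {set 'S_n} :=
  [set pi : 'S_n | all (avoids pi) Sigma].

Definition p132 : pattern :=
  Pattern (tperm (inord 1 : 'I_3) (inord 2 : 'I_3)).

Definition decreasing_pattern (m : nat) : pattern :=
  Pattern (perm (@rev_ord_inj m)).

Definition fp n (pi : 'S_n) : nat := #|[set i | pi i == i]|.
Definition exc n (pi : 'S_n) : nat := #|[set i : 'I_n | (i < pi i)%N]|.

(** The coefficient ring Q[x, q], built as Q[q][x]. *)
Notation Qxq := {poly {poly rat}}.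

Definition xvar : Qxq := 'X.
Definition qvar : Qxq := 'X%:P.

Definition F (Sigma : seq pattern) : {fps Qxq} :=
  \fps_n (\sum_(pi in Sav n Sigma) xvar ^+ fp pi * qvar ^+ exc pi).

(** Power series in p and z are series in p (outer) over series in z (inner):
    the sum of the G_k(z) p^k is [\fps_k G_k]. *)
Notation Qxqzp := {fps {fps Qxq}}.

Definition x_ : Qxqzp := xvar%:S%:S.
Definition q_ : Qxqzp := qvar%:S%:S.
Definition z_ : Qxqzp := (fpsX : {fps Qxq})%:S.
Definition p_ : Qxqzp := fpsX.

Definition f1 (R : comNzRingType) (q z p : R) : R :=
  1 - 2 * (1 + q) * z
    + ((1 - q) ^+ 2 - 2 * q * (p - 1) * (p + 3)) * z ^+ 2
    - 2 * q * (1 + q) * (p - 1) ^+ 2 * z ^+ 3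
    + q ^+ 2 * (p - 1) ^+ 4 * z ^+ 4.

Section Sanity.

Let const_term (R S : comNzRingType) (c : R -> S) (x q z p s : R) :
    {morph c : f g / f + g} -> {morph c : f / - f} ->
    {morph c : f g / f * g} -> c 1 = 1 -> c z = 0 -> c p = 0 ->
  c (f1 q z p) = 1 /\
  (c s = 1 ->
    c ((1 - p) * (1 + (1 + q - 2 * x) * z - q * z ^+ 2 * (p - 1) ^+ 2 + s)) = 2).
Proof.
move=> cD cN cM c1 cz cp; split=> [|cs]; rewrite /f1 !(cD, cN, cM, exprS).
  by rewrite cz c1 !(mulr0, mul0r, oppr0, addr0).
by rewrite cs cz cp c1 !(mulr0, mul0r, oppr0, addr0, subr0) mul1r.
Qed.

Let unit2 : (2 : Qxq) \is a GRing.unit.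
Proof.
have -> : 2 = (2 : rat)%:P%:P :> Qxq by rewrite !rmorph_nat.
by rewrite poly_unitE size_polyC !coefC /= polyC_eq0 poly_unitE size_polyC coefC.
Qed.

Let const_term00 s :
  let c (f : Qxqzp) := coefs (coefs f 0) 0 in
  c (f1 q_ z_ p_) = 1 /\
  (c s = 1 ->
    c ((1 - p_) * (1 + (1 + q_ - 2 * x_) * z_ - q_ * z_ ^+ 2 * (p_ - 1) ^+ 2
                   + s)) = 2).
Proof. by apply: const_term => // f g; rewrite !coefs0M. Qed.

Lemma sqr_sqrt_f1 : fps2_sqrt (f1 q_ z_ p_) ^+ 2 = f1 q_ z_ p_.
Proof. exact: sqr_fps2_sqrt unit2 (const_term00 0).1. Qed.

Lemma denominator_unit :
  (1 - p_) * (1 + (1 + q_ - 2 * x_) * z_ - q_ * z_ ^+ 2 * (p_ - 1) ^+ 2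
              + fps2_sqrt (f1 q_ z_ p_)) \is a GRing.unit.
Proof.
by rewrite !fps_unitE ((const_term00 _).2 (coefs00_fps2_sqrt _)) unit2.
Qed.

End Sanity.

(* Main.v *)
(** Pushing n, ..., 1 on a stack and popping them encodes a 132-avoiding
    permutation as a Dyck word. Left-to-right minima are the peaks of the word,
    and they count the longest decreasing subsequence. Entries are the tunnels
    (matched pairs of letters), and an entry is an excedance, a fixed point or
    neither according to the position of the middle of its tunnel with respect
    to the middle of the word.

    Removing the first and last letters of the word again and again turns it
    into a Motzkin path: every removed letter either opens a match or closes
    one that is already open, and by the idea of Elizalde and Pak the number of
    open matches determines which steps are possible and what they weigh.
    Peaks become a statistic on consecutive steps of the path. The derangement
    excursions E of these paths satisfy a quadratic equation, and the fixed
    points separate them, so that the generating function of the 132-avoiding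
    permutations is (1 + x z (p - 1)) / (1 - E - x z). *)

Require Import Defs.
From mathcomp Require Import all_boot all_order all_algebra all_fingroup.
From mathcomp Require Import zify ring.

Set Implicit Arguments.
Unset Strict Implicit.
Unset Printing Implicit Defensive.

Import GRing.Theory.
Local Open Scope ring_scope.

Section Words.
Local Open Scope nat_scope.

(** * Stack words and 132-avoiding sequences *)

(** [true] pushes the largest of the [c] values not yet pushed, [false] pops. *)
Fixpoint pops (c : nat) (S : seq nat) (w : seq bool) : seq nat :=
  match w with
  | [::] => [::]
  | true :: w' => pops c.-1 (c.-1 :: S) w'
  | false :: w' => head 0 S :: pops c (behead S) w'
  end.

Fixpoint valid (c : nat) (S : seq nat) (w : seq bool) : bool :=
  match w with
  | [::] => (c == 0) && nilp S
  | true :: w' => (0 < c) && valid c.-1 (c.-1 :: S) w'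
  | false :: w' => ~~ nilp S && valid c (behead S) w'
  end.

Fixpoint av132 (t : seq nat) : bool :=
  if t is a :: t' then sorted ltn [seq b <- t' | a < b] && av132 t' else true.

Lemma sorted_ltn_eq (s1 s2 : seq nat) :
  sorted ltn s1 -> sorted ltn s2 -> perm_eq s1 s2 -> s1 = s2.
Proof.
move=> s1P s2P /perm_mem; apply: (irr_sorted_eq ltn_trans ltnn) => //.
Qed.

Lemma filter_above c S : all (leq c) S -> [seq b <- iota 0 c ++ S | c <= b] = S.
Proof.
move=> cS; rewrite filter_cat (all_filterP cS) -[RHS]cat0s; congr (_ ++ _).
apply/eqP; rewrite -[_ == _]negbK -has_filter; apply/hasPn => b.
by rewrite mem_iota; lia.
Qed.

Lemma iota_rcons_cat c S : iota 0 c.+1 ++ S = iota 0 c ++ (c :: S).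
Proof. by rewrite -[c.+1]addn1 iotaD -catA. Qed.

Lemma perm_cons_cat v c S t :
  perm_eq (v :: t) (iota 0 c ++ v :: S) = perm_eq t (iota 0 c ++ S).
Proof. by rewrite perm_sym -[v :: S]cat1s perm_catCA perm_cons perm_sym. Qed.

(** The remaining stack [S] is recovered from the output as its entries that
    are at least [c], since smaller stack entries are popped first. *)
Lemma valid_pops c S w : sorted ltn S -> all (leq c) S -> valid c S w ->
  [/\ perm_eq (pops c S w) (iota 0 c ++ S), av132 (pops c S w)
    & [seq b <- pops c S w | c <= b] = S].
Proof.
elim: w c S => [|[] w IH] c S /= sS cS.
- by case/andP=> /eqP-> /nilP->.
- case: c cS => // c cS /= vw.
  have sS' : sorted ltn (c :: S) by rewrite /= (path_sortedE ltn_trans) sS andbT.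
  have cS' : all (leq c) (c :: S).
    by rewrite /= leqnn /=; apply: sub_all cS => b /ltnW.
  have [pe av fl] := IH _ _ sS' cS' vw; split=> //.
  + by move: pe; rewrite -iota_rcons_cat.
  + have := congr1 (filter (leq c.+1)) fl; rewrite -filter_predI /= ltnn.
    rewrite (all_filterP cS) => e; rewrite -[RHS]e; apply: eq_filter => b /=.
    by case: ltngtP => //; lia.
- case: S sS cS => // v S /= sS /andP[cv cS] vw.
  have sS' := path_sorted sS.
  have [pe av fl] := IH _ _ sS' cS vw; split.
  + by rewrite perm_cons_cat.
  + rewrite av andbT.
    have -> : [seq b <- pops c S w | v < b] = S; last by [].
      have := congr1 (filter (ltn v)) fl; rewrite -filter_predI.
      move: sS; rewrite (path_sortedE ltn_trans) => /andP[/all_filterP-> _] e.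
      rewrite -[RHS]e; apply: eq_filter => b /=.
      by case: (ltnP v b) => //= /ltnW/(leq_trans cv)->.
  + by rewrite cv fl.
Qed.

(** The first entry [v] of [t] dictates the letter. If [c <= v], it is the top of the stack and gets
    popped. Otherwise a value is pushed, and the new stack still lists the large entries of [t] in
    order: those after [v] exceed [v], so 132-avoidance makes them increase. *)
Lemma pops_surj (c : nat) (S t : seq nat) : sorted ltn S -> all (leq c) S ->
    perm_eq t (iota 0 c ++ S) -> av132 t -> [seq b <- t | c <= b] = S ->
  exists w, [/\ size w = c + size t, valid c S w & pops c S w = t].
Proof.
have [m] := ubnP (c + size t); elim: m c S t => // m IH c S [|v t] lt_m sS cS.
  move/perm_size; rewrite size_cat size_iota /= => /esym/eqP.
  rewrite addn_eq0 => /andP[/eqP c0 /nilP S0] _ _.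
  by exists [::]; rewrite c0 S0.
move=> pe av fl; have [lt_vc|le_cv] := ltnP v c; last first.
  move: fl; rewrite /= le_cv => eS; move: sS cS pe; rewrite -{}eS.
  set S' := filter _ _ => /= sS /andP[_ cS] pe.
  have [||||||w [sw vw pw]] := IH c S' t.
  - by move: lt_m => /=; lia.
  - exact: path_sorted sS.
  - by [].
  - by move: pe; rewrite perm_cons_cat.
  - by case/andP: av.
  - by [].
  by exists (false :: w); split; rewrite /= ?vw ?pw // sw addnS.
case: c lt_m cS pe fl lt_vc => // c lt_m cS pe fl lt_vc.
have sS' : sorted ltn (c :: S) by rewrite /= (path_sortedE ltn_trans) sS andbT.
have cS' : all (leq c) (c :: S).
  by rewrite /= leqnn /=; apply: sub_all cS => b /ltnW.
have pe' : perm_eq (v :: t) (iota 0 c ++ (c :: S)).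
  by rewrite -iota_rcons_cat.
have [||||||w [sw vw pw]] := IH c (c :: S) (v :: t) => //; last first.
  by exists (true :: w); rewrite /= sw vw pw.
- apply: sorted_ltn_eq => //; last first.
    by rewrite -[X in perm_eq _ X](filter_above cS'); apply: perm_filter.
  have /andP[av1 _] := av.
  have sv : sorted ltn [seq b <- t | c <= b & v < b].
    by rewrite filter_predI; apply: sorted_filter => //; exact: ltn_trans.
  have Uvt : uniq (v :: t).
    rewrite (perm_uniq pe') cat_uniq iota_uniq (sorted_uniq ltn_trans ltnn sS').
    by rewrite andbT; apply/hasPn => b /(allP cS'); rewrite mem_iota; lia.
  have eqf : [seq b <- t | c <= b & v < b] = [seq b <- t | c <= b].
    apply: eq_in_filter => b bt; have [cb|//] := boolP (c <= b) => /=.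
    have : b != v by apply: contraTneq bt => ->; case/andP: Uvt.
    by lia.
  rewrite eqf in sv; rewrite /=; case: ifP => //= cv.
  rewrite (path_sortedE ltn_trans) sv andbT.
  by rewrite -eqf; apply/allP => b; rewrite mem_filter => /andP[/andP[]].
Qed.

(** The first letter can be read off the output: a pop yields a value at least [c], whereas after a
    push the next value is at most the one pushed, [c.-1]. *)
Lemma pops_inj c S w1 w2 : sorted ltn S -> all (leq c) S ->
  valid c S w1 -> valid c S w2 -> pops c S w1 = pops c S w2 -> w1 = w2.
Proof.
(* The default value [c'.+1] breaks the bound, which therefore also rules out an empty output. *)
have firstpush c' S' w' : valid c' (c' :: S') w' ->
    head c'.+1 (pops c' (c' :: S') w') <= c'.
  elim: w' c' S' => [|[] w' IH] c' S' //=; first by rewrite andbF.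
  case: c' => //= c' /IH.
  by case: (pops _ _ _) => /=; lia.
elim: w1 w2 c S => [|[] w1 IH] [|[] w2] c S //= sS cS.
- by case/andP=> /eqP->.
- by case: c cS => [|c] cS H /andP[].
- case: c cS => //= c cS v1 v2 e; congr cons; apply: IH v1 v2 e.
    by rewrite /= (path_sortedE ltn_trans) sS andbT.
  by rewrite /= leqnn /=; apply: sub_all cS => b /ltnW.
- case: c cS => //= c cS /firstpush h /andP[+ _] e; move: h; rewrite e /=.
  by case: S {sS e} cS => //= a S /andP[]; lia.
- move=> /andP[+ _] /andP[c0]; case: c cS c0 => //= c cS _ nS /firstpush h e; move: h.
  rewrite -e /=.
  by case: S {sS e} cS nS => //= a S /andP[]; lia.
- case: S sS cS => //= a S sS /andP[_ cS] v1 v2 [e]; congr cons.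
  by apply: IH v1 v2 e => //; exact: path_sorted sS.
Qed.

End Words.

(** * Weights of words and their outermost pairs of letters *)

Section Tunnels.
Variables (R : comNzRingType) (x q p : R).

(** [a] and [b] are the positions of two matched letters in a word of length
    [N]: the weight tells on which side of the middle of the word the middle of
    the tunnel lies. *)
Definition tunnel_wt (N a b : nat) : R :=
  if (a + b + 1 < N)%N then q else if (a + b + 1 == N)%N then x else 1.

(** [U] is the stack of positions of the unmatched [true]s on the left; a
    [false] that meets an empty stack stays unmatched and has weight 1. *)
Fixpoint scan_wt (N k : nat) (U : seq nat) (w : seq bool) : R :=
  match w with
  | [::] => 1
  | true :: w' => scan_wt N k.+1 (k :: U) w'
  | false :: w' =>
      (if U is a :: _ then tunnel_wt N a k else 1) * scan_wt N k.+1 (behead U) w'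
  end.

Fixpoint stack (k : nat) (U : seq nat) (w : seq bool) : seq nat :=
  match w with
  | [::] => U
  | true :: w' => stack k.+1 (k :: U) w'
  | false :: w' => stack k.+1 (behead U) w'
  end.

Fixpoint downs (u : nat) (w : seq bool) : nat :=
  match w with
  | [::] => 0
  | true :: w' => downs u.+1 w'
  | false :: w' => (u == 0) + downs u.-1 w'
  end%N.

Definition ups w := size (stack 0 [::] w).

Fixpoint peaks (l : bool) (w : seq bool) : nat :=
  if w is b :: w' then ((l && ~~ b) + peaks b w')%N else 0%N.

Lemma wt_rcons N k U w b :
  scan_wt N k U (rcons w b) = scan_wt N k U w *
    (if b then 1
     else if stack k U w is a :: _ then tunnel_wt N a (k + size w) else 1).
Proof.
elim: w k U => [|[] w IH] k U /=; last 2 [by rewrite IH addSnnS];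
  last by rewrite IH addSnnS mulrA.
by case: b; rewrite /= ?addn0 mul1r ?mulr1.
Qed.

Lemma stack_rcons k U w b :
  stack k U (rcons w b) =
    if b then (k + size w)%N :: stack k U w else behead (stack k U w).
Proof.
by elim: w k U => [|[] w IH] k U /=; rewrite ?addn0 ?IH ?addSnnS //; case: b.
Qed.

Lemma downs_rcons k U w b :
  downs (size U) (rcons w b) =
    (downs (size U) w + (~~ b && nilp (stack k U w)))%N.
Proof.
elim: w k U => [|[] w IH] k U /=.
- by case: b; rewrite /= ?addn0.
- by rewrite -[(size U).+1]/(size (k :: U)) (IH k.+1).
- by rewrite -size_behead (IH k.+1) addnA.
Qed.

Lemma peaks_rcons l w b c :
  peaks l (rcons (rcons w b) c) = (peaks l (rcons w b) + (b && ~~ c))%N.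
Proof. by elim: w l => [|a w IH] l /=; rewrite ?addn0 ?IH ?addnA. Qed.

Lemma downsS u w : downs u.+1 w = (downs u w).-1.
Proof. by elim: w u => [|[] w IH] [|u] //=; rewrite IH. Qed.

(** The extra [true] at [a], at the bottom of the stack, meets the first [false] that the rest
    leaves unmatched, if any. The bound on [a] puts the middle of that tunnel left of the centre,
    whence [q]. *)
Lemma wt_bottom N k U a w : (a + k + size w < N)%N ->
  scan_wt N k (rcons U a) w =
    (if (0 < downs (size U) w)%N then q else 1) * scan_wt N k U w.
Proof.
elim: w k U => [|[] w IH] k U /= ltN; first by rewrite mulr1.
  by rewrite -rcons_cons IH //=; lia.
case: U => [|b U] /=; last by rewrite IH /=; [rewrite mulrCA|lia].
by rewrite mul1r /tunnel_wt ifT //; lia.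
Qed.

Lemma stack_bottom k U a w :
  stack k (rcons U a) w =
    if (0 < downs (size U) w)%N then stack k U w else rcons (stack k U w) a.
Proof.
elim: w k U => [|[] w IH] k U //=; first by rewrite -rcons_cons IH.
by case: U => [|b U] //=; rewrite IH.
Qed.

(** A letter added at each end of the word moves both ends of a tunnel and the centre by one
    place. *)
Lemma wt_shift N k U w : scan_wt N.+2 k.+1 (map succn U) w = scan_wt N k U w.
Proof.
elim: w k U => [|[] w IH] k U //=; first by rewrite -(IH k.+1).
rewrite behead_map IH; case: U => //= b U; congr (_ * _).
by rewrite /tunnel_wt !(addSn, addnS, ltnS, eqSS).
Qed.

Lemma stack_shift k U w : stack k.+1 (map succn U) w = map succn (stack k U w).
Proof.
by elim: w k U => [|[] w IH] k U /=; rewrite ?behead_map -1?(IH k.+1).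
Qed.

Definition word_wt w := scan_wt (size w) 0 [::] w.

Lemma word_wt_uu w :
  word_wt (true :: rcons w true) = (if (0 < downs 0 w)%N then q else 1) * word_wt w.
Proof.
rewrite /word_wt /= wt_rcons mulr1 -[[:: 0%N]]/(rcons [::] 0%N).
rewrite wt_bottom ?size_rcons //.
by rewrite (wt_shift _ _ [::]).
Qed.

(** The new [true] meets an unmatched [false] of [w], or the new [false] when nothing in [w] is
    pending; the latter tunnel is centred. If the new [false] meets a letter of [w], its tunnel lies
    on the right and weighs 1. *)
Lemma word_wt_ud w : word_wt (true :: rcons w false) =
  (if (0 < downs 0 w)%N then q else if ups w == 0%N then x else 1) * word_wt w.
Proof.
rewrite /word_wt /= wt_rcons -[[:: 0%N]]/(rcons [::] 0%N).
rewrite wt_bottom ?size_rcons //.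
rewrite (wt_shift _ _ [::]) stack_bottom /= (stack_shift _ [::]) /ups mulrAC.
congr (_ * _); case: ifP => _; case: (stack 0 [::] w) => [|a s] /=;
  rewrite ?mulr1 ?mul1r //.
- by rewrite /tunnel_wt !ifF ?mulr1 //; lia.
- by rewrite /tunnel_wt ifF ?ifT //; lia.
- by rewrite /tunnel_wt !ifF ?mulr1 //; lia.
Qed.

Lemma word_wt_du w : word_wt (false :: rcons w true) = word_wt w.
Proof. by rewrite /word_wt /= wt_rcons mulr1 size_rcons mul1r (wt_shift _ _ [::]). Qed.

Lemma word_wt_dd w : word_wt (false :: rcons w false) = word_wt w.
Proof.
rewrite /word_wt /= wt_rcons size_rcons mul1r (wt_shift _ _ [::]) (stack_shift _ [::]).
case: (stack 0 [::] w) => [|a s] /=; rewrite ?mulr1 //.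
by rewrite /tunnel_wt !ifF ?mulr1 //; lia.
Qed.

Lemma downs_uu w : downs 0 (true :: rcons w true) = (downs 0 w).-1.
Proof. by rewrite /= (downs_rcons 0 [:: 0%N]) addn0 downsS. Qed.

Lemma size_stack1 w : size (stack 1 [:: 0%N] w) = (ups w + (downs 0 w == 0))%N.
Proof.
rewrite -[[:: 0%N]]/(rcons [::] 0%N) stack_bottom (stack_shift _ [::]) lt0n.
by case: eqP => _ /=; rewrite ?size_rcons size_map ?addn1 ?addn0.
Qed.

Lemma ups_uu w : ups (true :: rcons w true) = (ups w + (downs 0 w == 0)).+1%N.
Proof. by rewrite /ups /= stack_rcons /= size_stack1. Qed.

Lemma downs_ud w : downs 0 (true :: rcons w false) =
  ((downs 0 w).-1 + (ups w + (downs 0 w == 0) == 0))%N.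
Proof. by rewrite /= (downs_rcons 1 [:: 0%N]) /= downsS /nilp size_stack1. Qed.

Lemma ups_ud w : ups (true :: rcons w false) = (ups w + (downs 0 w == 0)).-1%N.
Proof. by rewrite /ups /= stack_rcons /= size_behead size_stack1. Qed.

Lemma downs_du w : downs 0 (false :: rcons w true) = (downs 0 w).+1.
Proof. by rewrite /= (downs_rcons 1 [::]) addn0. Qed.

Lemma ups_du w : ups (false :: rcons w true) = (ups w).+1.
Proof. by rewrite /ups /= stack_rcons /= (stack_shift _ [::]) size_map. Qed.

Lemma downs_dd w : downs 0 (false :: rcons w false) = (downs 0 w + (ups w == 0)).+1%N.
Proof. by rewrite /= (downs_rcons 0 [::]). Qed.

Lemma ups_dd w : ups (false :: rcons w false) = (ups w).-1.
Proof. by rewrite /ups /= stack_rcons /= (stack_shift _ [::]) size_behead size_map. Qed.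

(** * Sums over words of even length *)

Definition letters2 :=
  [:: (true, true); (true, false); (false, true); (false, false)].

(** Words grow from the middle outwards, so that the recursion strips the two outer letters. *)
Fixpoint ewords (n : nat) : seq (seq bool) :=
  if n is n'.+1 then [seq b.1 :: rcons w b.2 | w <- ewords n', b <- letters2]
  else [:: [::]].

Lemma ewordsS n :
  ewords n.+1 = [seq b.1 :: rcons w b.2 | w <- ewords n, b <- letters2].
Proof. by []. Qed.

Lemma mem_ewords n w : (w \in ewords n) = (size w == n.*2).
Proof.
elim: n w => [|n IH] w; first by rewrite mem_seq1 size_eq0.
rewrite ewordsS.
apply/allpairsPdep/idP => [[u [b [un _ ->]]]|].
  by move: un; rewrite /= size_rcons IH.
case: w => [|a w] //; case/lastP: w => [|w b] //; rewrite /= size_rcons !eqSS -IH => wn.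
by exists w, (a, b); split; rewrite //= !inE; case: (a); case: (b).
Qed.

Lemma uniq_ewords n : uniq (ewords n).
Proof.
elim: n => // n IH; rewrite ewordsS; apply: allpairs_uniq => //.
move=> [w1 [a1 b1]] [w2 [a2 b2]] _ _ /=.
by case=> -> /rcons_inj[-> ->].
Qed.

Definition kron (a h i j : nat) : R := ((a == i) && (h == j))%:R.

(** An arbitrary word reduces to [i] unmatched [false]s followed by [j]
    unmatched [true]s; [L] and [M] are the letters around the word. *)
Definition word_sum n i j L M : R :=
  \sum_(w <- ewords n)
    p ^+ peaks L (rcons w M) * word_wt w * kron (downs 0 w) (ups w) i j.

(** Each [peel] operator collects the counts of inner words that the given pair of outer letters
    turns into [(i, j)]. A [true] on the left uses up an unmatched [false] at weight [q]; a [false]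
    on the right uses up an unmatched [true] at weight 1. *)
Definition peel_uu (f : nat -> nat -> R) i j : R :=
  match i, j with
  | 0%N, j'.+2 => q * f 1%N j'.+1 + f 0%N j'
  | 0%N, 1%N => q * f 1%N 0%N
  | i'.+1, j'.+1 => q * f i'.+2 j'
  | _, _ => 0
  end.

Definition peel_ud (f : nat -> nat -> R) i j : R :=
  match i, j with
  | 0%N, 0%N => q * f 1%N 1%N + x * f 0%N 0%N
  | 0%N, j'.+1 => q * f 1%N j'.+2 + f 0%N j'.+1
  | i'.+1, 0%N => q * f i'.+2 1%N + q * f i'.+1 0%N
  | i'.+1, j'.+1 => q * f i'.+2 j'.+2
  end.

Definition peel_du (f : nat -> nat -> R) i j : R :=
  match i, j with i'.+1, j'.+1 => f i' j' | _, _ => 0 end.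

Definition peel_dd (f : nat -> nat -> R) i j : R :=
  match i, j with
  | i'.+2, 0%N => f i'.+1 1%N + f i' 0%N
  | 1%N, 0%N => f 0%N 1%N
  | i'.+1, j'.+1 => f i' j'.+2
  | _, _ => 0
  end.

Lemma peaks_ctx L b1 w b2 M : p ^+ peaks L (rcons (b1 :: rcons w b2) M) =
  p ^+ ((L && ~~ b1) + (b2 && ~~ M)) * p ^+ peaks b1 (rcons w b2).
Proof. by rewrite /= peaks_rcons -exprD; congr (_ ^+ _); lia. Qed.

Lemma kron_uu a h i j :
  (if (0 < a)%N then q else 1) * kron a.-1 (h + (a == 0%N)).+1 i j =
  peel_uu (kron a h) i j.
Proof.
rewrite /kron; case: a i j => [|[|a]] [|i] [|[|j]] /=;
  rewrite ?addn0 ?addn1 ?eqSS ?andbF ?mulr0 ?addr0 ?add0r ?mul1r //.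
Qed.

Lemma kron_ud a h i j :
  (if (0 < a)%N then q else if h == 0%N then x else 1) *
    kron (a.-1 + (h + (a == 0%N) == 0%N)) (h + (a == 0%N)).-1 i j =
  peel_ud (kron a h) i j.
Proof.
rewrite /kron; case: a h i j => [|[|a]] [|[|h]] [|i] [|[|j]] /=;
  rewrite ?addn0 ?addn1 ?eqSS ?andbF ?mulr0 ?addr0 ?add0r ?mul1r //=.
Qed.

Lemma kron_du a h i j : kron a.+1 h.+1 i j = peel_du (kron a h) i j.
Proof. by case: i j => [|i] [|j]; rewrite /kron /= ?eqSS ?andbF. Qed.

Lemma kron_dd a h i j :
  kron (a + (h == 0%N)).+1 h.-1 i j = peel_dd (kron a h) i j.
Proof.
rewrite /kron; case: a h i j => [|a] [|[|h]] [|[|i]] [|j] /=;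
  rewrite ?addn0 ?addn1 ?eqSS ?andbF ?mulr0 ?addr0 ?add0r ?mul1r //=.
Qed.

Lemma letters2_sum (f : bool -> bool -> R) :
  \sum_(b <- letters2) f b.1 b.2 =
  f true true + f true false + f false true + f false false.
Proof. by rewrite /letters2 !big_cons big_nil /= addr0 !addrA. Qed.

Section Linear.
Variables (T : Type) (s : seq T) (c : T -> R) (f : T -> nat -> nat -> R).
Let g i j := \sum_(w <- s) c w * f w i j.

Lemma peel_uu_sum i j : \sum_(w <- s) c w * peel_uu (f w) i j = peel_uu g i j.
Proof.
by case: i j => [|i] [|[|j]] /=;
  do ?[by rewrite big1 // => w _; rewrite mulr0];
  rewrite ?mulr_sumr -?big_split /=; apply: eq_bigr => w _; ring.
Qed.

Lemma peel_ud_sum i j : \sum_(w <- s) c w * peel_ud (f w) i j = peel_ud g i j.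
Proof.
by case: i j => [|i] [|[|j]] /=;
  rewrite ?mulr_sumr -?big_split /=; apply: eq_bigr => w _; ring.
Qed.

Lemma peel_du_sum i j : \sum_(w <- s) c w * peel_du (f w) i j = peel_du g i j.
Proof.
by case: i j => [|i] [|j] //=; rewrite big1 // => w _; rewrite mulr0.
Qed.

Lemma peel_dd_sum i j : \sum_(w <- s) c w * peel_dd (f w) i j = peel_dd g i j.
Proof.
by case: i j => [|[|i]] [|j] //=;
  do ?[by rewrite big1 // => w _; rewrite mulr0];
  rewrite ?mulr_sumr -?big_split /=; apply: eq_bigr => w _; ring.
Qed.

End Linear.

(** The outer two letters become the context of the inner word; the only peaks lost in passing to it
    are those at the junctions with [L] and [M]. *)
Lemma word_sum_peel n i j L M :
  word_sum n.+1 i j L M =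
    p ^+ (~~ M) * peel_uu (fun i j => word_sum n i j true true) i j
    + peel_ud (fun i j => word_sum n i j true false) i j
    + p ^+ (L + ~~ M) * peel_du (fun i j => word_sum n i j false true) i j
    + p ^+ L * peel_dd (fun i j => word_sum n i j false false) i j.
Proof.
rewrite -peel_uu_sum -peel_ud_sum -peel_du_sum -peel_dd_sum.
rewrite !mulr_sumr -!big_split /word_sum ewordsS big_allpairs_dep.
apply: eq_bigr => w _.
rewrite (letters2_sum (fun b1 b2 => p ^+ peaks L (rcons (b1 :: rcons w b2) M)
  * word_wt (b1 :: rcons w b2)
  * kron (downs 0 (b1 :: rcons w b2)) (ups (b1 :: rcons w b2)) i j)).
rewrite !peaks_ctx word_wt_uu word_wt_ud word_wt_du word_wt_dd.
rewrite downs_uu downs_ud downs_du downs_dd.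
rewrite ups_uu ups_ud ups_du ups_dd.
rewrite -kron_uu -kron_ud -kron_du -kron_dd /= !andbF !andbT !addn0 expr0.
ring.
Qed.

End Tunnels.

(** * Collapse to Motzkin paths *)

(** The possible outer letters: two opening ends (U), an opening and a closing
    one (A), a closing and an opening one (B), two closing ends (D; also the
    context of a whole word), and a centred tunnel (F). *)
Inductive context := CU | CA | CB | CD | CF.

Definition new_peaks (C C' : context) : nat :=
  match C, C' with
  | CU, CD => 2
  | CU, CA | CU, CB | CA, CB | CA, CD | CB, CA | CB, CD => 1
  | _, _ => 0
  end.

(** Seen from outside, [L = true] opens a match when the inner word offers an unmatched [false]
    ([i > 0]), and [M = false] when it offers an unmatched [true] ([j > 0]). With nothing pending
    these two letters meet each other, which is [CF]. Any other letter closes. *)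
Definition context_of (i j : nat) (L M : bool) : context :=
  match L, M with
  | true, false => match i, j with
                   | 0, 0 => CF | 0, _.+1 => CB | _.+1, 0 => CA | _, _ => CU end
  | true, true => if i is 0 then CD else CA
  | false, false => if j is 0 then CD else CB
  | false, true => CD
  end.

Section Motzkin.
Variables (R : comNzRingType) (x q p : R).

(** [h] counts pending matches and moves by 0 or 2. An opening end on the left starts a tunnel left
    of the centre, hence [q] in the U and A steps. The base value [p] is the peak of a centred pair
    that encloses nothing. *)
Fixpoint motz (n h : nat) (C : context) : R :=
  match n, h with
  | 0, 0 => if C is CF then p else 1
  | 0, _.+1 => 0
  | n'.+1, h'.+2 => q * p ^+ new_peaks C CU * motz n' h'.+4 CU
      + q * p ^+ new_peaks C CA * motz n' h'.+2 CA
      + p ^+ new_peaks C CB * motz n' h'.+2 CB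
      + p ^+ new_peaks C CD * motz n' h' CD
  | n'.+1, _ => q * motz n' 2 CU + x * motz n' 0 CF
  end.

(** The point of the recursion: only the number [i + j] of pending matches and
    the context matter, although the letters producing a given context depend
    on [i] and [j] separately. *)
Lemma word_sum_motz n i j L M : ~~ odd (i + j) ->
  word_sum x q p n i j L M = motz n (i + j) (context_of i j L M).
Proof.
elim: n i j L M => [|n IH] i j L M ev.
  rewrite /word_sum big_seq1 /= /kron /word_wt /ups /= mulr1 addn0.
  case: i j {ev} => [|i] [|j]; rewrite /= ?mulr0 ?mulr1 //.
  by case: L M => [] []; rewrite /= ?expr0 ?expr1.
rewrite word_sum_peel; case: i j ev => [|[|i]] [|[|j]] ev //=.
all: rewrite !IH ?(addnS, addSn, addn0, add0n) //=;
  try (by move: ev; rewrite ?(addnS, addSn, addn0, add0n) //= ?negbK).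
all: by case: L M => [] [] /=; ring.
Qed.
End Motzkin.

(** * Generating functions *)

(** [Y C] is the series of the descents, by one level, of the Motzkin paths that
    start in context [C]. *)
Definition descent_system (R : comNzRingType) (q z p : R) (Y : context -> R) :=
  forall C, Y C = z * (q * p ^+ new_peaks C CU * (Y CU * Y CD)
    + q * p ^+ new_peaks C CA * Y CA + p ^+ new_peaks C CB * Y CB + p ^+ new_peaks C CD).

(** Once [E = q z YU] is regarded as known, the equations for A, B and D are linear, with
    determinant [B]; the equation for U then amounts to the quadratic equation for [E]. Subtracting
    the equation for D, where no step makes a peak, leaves multiples of [k = p - 1]. *)
Lemma descent_solution (R : comUnitRingType) (q z p E : R) :
  let k := p - 1 in
  let m := 1 - (1 + q) * z + q * z ^+ 2 * k ^+ 2 - E in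
  let B := (1 - q * z ^+ 2 * k ^+ 2) * (1 - E) - (1 + q) * z
           - 2 * q * z ^+ 2 * k in
  E * m = p ^+ 2 * q * z ^+ 2 -> m \is a GRing.unit -> B \is a GRing.unit ->
  exists2 Y, descent_system q z p Y & q * z * Y CU = E.
Proof.
move=> k m B Em Um UB.
(* [t] is the common value of [YA / (1 + z k)] and [YB / (1 + q z k)] when the differences of the A,
   B and D equations are solved. *)
pose t := z * (p - k * E) / B.
have tB : t * B = z * (p - k * E) by rewrite divrK.
pose YU := p ^+ 2 * z / m.
have YUm : YU * m = p ^+ 2 * z by rewrite divrK.
have eqE : q * z * YU = E.
  by apply: (mulIr Um); rewrite Em -[_ * YU * m]mulrA YUm; ring.
pose YA := (1 + z * k) * t; pose YB := (1 + q * z * k) * t.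
pose YD := (1 - q * z ^+ 2 * k ^+ 2) * t - z * k.
have eqD : YD = E * YD + z * (q * YA + YB + 1).
  apply/eqP; rewrite -subr_eq0; apply/eqP.
  transitivity (t * B - z * k * (1 - E) - z); first by rewrite /YD /YA /YB /B; ring.
  by rewrite tB /k; ring.
have eqU : YU = YD + z * k * (q * YA + YB + p + 1).
  apply: (mulIr (_ : m * B \is a GRing.unit)); first by rewrite unitrM Um.
  apply/eqP; rewrite -subr_eq0; apply/eqP.
  set G := 1 + q * z ^+ 2 * k ^+ 2 + z * k * (1 + q).
  transitivity (YU * m * B - m * (t * B) * G - z * k * p * m * B).
    by rewrite /YD /YA /YB /G /k; ring.
  (* Cleared of the denominators [m] and [B], the equation is a multiple of the quadratic one. *)
  transitivity (z * (E * m - p ^+ 2 * q * z ^+ 2)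
     * (k * G + k * p - k ^+ 3 * p * q * z ^+ 2)).
    by rewrite YUm tB /B /G /m /k; ring.
  by rewrite Em subrr mulr0 mul0r.
exists (fun C => match C with CU => YU | CA => YA | CB => YB | _ => YD end) => //.
have eqE' : z * (q * (YU * YD)) = E * YD by rewrite -eqE; ring.
have eqA : YA = YD + z * k * (YB + 1) by rewrite /YA /YB /YD; ring.
have eqB : YB = YD + z * k * (q * YA + 1) by rewrite /YA /YB /YD; ring.
clearbody YU YA YB YD.
case; rewrite /= ?expr0 ?expr1 ?mulr1 ?mul1r.
- by rewrite [LHS]eqU {1}eqD -eqE' /k; ring.
- by rewrite [LHS]eqA {1}eqD -eqE' /k; ring.
- by rewrite [LHS]eqB {1}eqD -eqE' /k; ring.
- by rewrite [LHS]eqD -eqE'; ring.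
- by rewrite [LHS]eqD -eqE'; ring.
Qed.

(** * Series in z with coefficients in p, rewritten as series in p *)

Section Swap.
Variable K : comNzRingType.

Lemma coefs_sum (T : comNzRingType) (I : Type) (s : seq I) (P : pred I)
    (f : I -> {fps T}) n :
  coefs (\sum_(i <- s | P i) f i) n = \sum_(i <- s | P i) coefs (f i) n.
Proof. by elim/big_rec2: _ => // i a b _ <-. Qed.

Lemma coefs_fpsXM (T : comNzRingType) (f : {fps T}) n :
  coefs (fpsX * f) n = if n is m.+1 then coefs f m else 0.
Proof.
case: n => [|n]; first by rewrite coefs0M mul0r.
rewrite coefsM big_ord_recl mul0r add0r big_ord_recl mul1r subSS subn0.
by rewrite big1 ?addr0 // => i _; rewrite mul0r.
Qed.

(** The series whose coefficient of [z^n] is [u n]. *)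
Definition swap_zp (u : nat -> {fps K}) : {fps {fps K}} :=
  \fps_k \fps_n coefs (u n) k.

Definition const_z (a : {fps K}) : {fps {fps K}} := \fps_k (coefs a k)%:S.

Definition zser : {fps {fps K}} := (fpsX : {fps K})%:S.

Lemma coefs2P (f g : {fps {fps K}}) :
  (forall k n, coefs (coefs f k) n = coefs (coefs g k) n) -> f = g.
Proof. by move=> fg; apply: fpsP => k; apply: fpsP => n. Qed.

Lemma swap_zp_scale a u : swap_zp (fun n => a * u n) = const_z a * swap_zp u.
Proof.
apply: coefs2P => k n; rewrite coefsM coefs_sum.
by apply: eq_bigr => i _; rewrite coefsCM.
Qed.

Lemma swap_zpD u1 u2 : swap_zp (fun n => u1 n + u2 n) = swap_zp u1 + swap_zp u2.
Proof. exact: coefs2P. Qed.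

Lemma swap_zp_recl u : swap_zp u = const_z (u 0%N) + zser * swap_zp (fun n => u n.+1).
Proof.
apply: coefs2P => k [|n]; rewrite !(coefsD, coefsCM, coefs_fpsXM) /= ?addr0 ?add0r //.
Qed.

Lemma swap_zp_const a : swap_zp (fun n => if n is 0 then a else 0) = const_z a.
Proof. by apply: coefs2P => k [|n]. Qed.

Lemma eq_swap_zp u1 u2 : u1 =1 u2 -> swap_zp u1 = swap_zp u2.
Proof. by move=> /boolp.funext->. Qed.

Lemma const_zM a b : const_z (a * b) = const_z a * const_z b.
Proof.
rewrite -(swap_zp_const b) -swap_zp_scale -swap_zp_const.
by apply: eq_swap_zp => -[|n]; rewrite ?mulr0.
Qed.

Lemma const_z1 : const_z 1 = 1.
Proof.
apply: fpsP => k; rewrite /= /fpsC; apply: fpsP => n /=.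
by case: k n => [|k] [|n].
Qed.

Lemma const_z0 : const_z 0 = 0.
Proof. by apply: coefs2P => k [|n]. Qed.

Lemma const_zX a n : const_z (a ^+ n) = const_z a ^+ n.
Proof. by elim: n => [|n IH]; rewrite ?const_z1 // !exprS const_zM IH. Qed.

Lemma const_z_const c : const_z c%:S = c%:S%:S.
Proof. by apply: coefs2P => -[|k] [|n]. Qed.

Lemma const_z_fpsX : const_z fpsX = fpsX.
Proof. by apply: coefs2P => -[|[|k]] [|n]. Qed.

Lemma zdiv_eq0 (f : {fps {fps K}}) :
  (forall n, exists g, f = zser ^+ n * g) -> f = 0.
Proof.
have lowz g n k m : (m < n)%N -> coefs (coefs (zser ^+ n * g) k) m = 0.
  elim: n m => // n IH m lt_mn; rewrite exprS -mulrA coefsCM coefs_fpsXM.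
  by case: m lt_mn => // m /IH.
by move=> fP; apply: coefs2P => k m; have [g ->] := fP m.+1; rewrite lowz.
Qed.

End Swap.

(** * Series of the Motzkin paths *)

Section Motzkin_series.
Variables (K : comNzRingType) (x q : K).
Let X := x%:S%:S : {fps {fps K}}.
Let Q := q%:S%:S : {fps {fps K}}.
Let P := fpsX : {fps {fps K}}.
Let z := zser K.

Definition motz_series h C : {fps {fps K}} :=
  swap_zp (fun n => motz x%:S q%:S fpsX n h C).

Lemma motz_seriesS h C : motz_series h.+2 C =
  z * (Q * P ^+ new_peaks C CU * motz_series h.+4 CU
    + Q * P ^+ new_peaks C CA * motz_series h.+2 CA
    + P ^+ new_peaks C CB * motz_series h.+2 CB
    + P ^+ new_peaks C CD * motz_series h CD).
Proof.
rewrite {1}/motz_series swap_zp_recl const_z0 add0r !swap_zpD !swap_zp_scale.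
by rewrite !const_zM !const_zX const_z_fpsX const_z_const.
Qed.

Lemma motz_series0 C : motz_series 0 C =
  (if C is CF then P else 1)
  + z * (Q * motz_series 2 CU + X * motz_series 0 CF).
Proof.
rewrite {1}/motz_series swap_zp_recl !swap_zpD !swap_zp_scale !const_z_const.
by case: C; rewrite ?const_z1 ?const_z_fpsX.
Qed.

(** The differences of the two sides satisfy a homogeneous linear system with
    a factor [z], so they are divisible by every power of [z]. *)
Lemma motz_series_descent Y h C : descent_system Q z P Y ->
  motz_series h.+2 C = Y C * motz_series h CD.
Proof.
move=> YP; apply/eqP; rewrite -subr_eq0; apply/eqP/zdiv_eq0 => n.
elim: n h C => [|n IH] h C; first by eexists; rewrite expr0 mul1r.
have [gU eU] := IH h.+2 CU; have [gD eD] := IH h CD.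
have [gA eA] := IH h CA; have [gB eB] := IH h CB.
exists (Q * P ^+ new_peaks C CU * (gU + Y CU * gD) + Q * P ^+ new_peaks C CA * gA
  + P ^+ new_peaks C CB * gB).
rewrite exprSr motz_seriesS YP.
transitivity (z * (Q * P ^+ new_peaks C CU *
    ((motz_series h.+4 CU - Y CU * motz_series h.+2 CD)
     + Y CU * (motz_series h.+2 CD - Y CD * motz_series h CD))
  + Q * P ^+ new_peaks C CA * (motz_series h.+2 CA - Y CA * motz_series h CD)
  + P ^+ new_peaks C CB * (motz_series h.+2 CB - Y CB * motz_series h CD))).
  by ring.
by rewrite eU eD eA eB /z; ring.
Qed.

End Motzkin_series.

(** * Permutations *)

Section Dictionary.
Variables (R : comNzRingType) (x q : R).

Lemma size_stack k U w :
  (size (stack k U w) + count negb w = downs (size U) w + count id w + size U)%N.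
Proof.
elim: w k U => [|[] w IH] k U //=.
- by rewrite addn0.
- by have := IH k.+1 (k :: U) => /=; lia.
- have := IH k.+1 (behead U); rewrite size_behead; case: U => [|a U] /=; lia.
Qed.

(** Validity depends on the height of the stack only, so values may be replaced by positions. *)
Lemma valid_downs c S k U w : size U = size S ->
  valid c S w = [&& downs (size S) w == 0%N, nilp (stack k U w) & count id w == c].
Proof.
elim: w c S k U => [|[] w IH] c S k U /= US.
- by rewrite /nilp US eq_sym andbC.
- rewrite (IH _ _ k.+1 (k :: U)) /= ?US //.
  by case: c => [|c]; rewrite //= !andbF.
- case: S U US => [|v S] [|a U] //= [US]; rewrite add0n.
  exact: IH.
Qed.

(** If every letter is matched, half of the [n.*2] letters are pushes, as many as there are
    values. *)
Lemma valid_ewords n w : w \in ewords n ->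
  valid n [::] w = (downs 0 w == 0%N) && (ups w == 0%N).
Proof.
rewrite mem_ewords (valid_downs _ 0 _ (U := [::])) // => /eqP sw.
have e1 := size_stack 0 [::] w; rewrite -/(ups w) /= addn0 in e1.
have e2 : (count id w + count negb w = n.*2)%N by rewrite -sw -(count_predC id).
rewrite /nilp -/(ups w).
by case: eqP => //= l0; case: eqP => //= h0; apply/eqP; lia.
Qed.

Definition entry_wt (i v : nat) : R :=
  if (i < v)%N then q else if i == v then x else 1.

Fixpoint oneline_wt (i : nat) (t : seq nat) : R :=
  if t is v :: t' then entry_wt i v * oneline_wt i.+1 t' else 1.

(** The position in the word at which a value was pushed is determined by the
    value and its height in the stack. *)
Fixpoint stacks_agree (n : nat) (U S : seq nat) : Prop :=
  match U, S with
  | [::], [::] => True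
  | a :: U', v :: S' =>
      (a + size S + 1 + v.*2 = n.*2)%N /\ stacks_agree n U' S'
  | _, _ => False
  end.

(** At position [k] there have been [n - c] pushes and [i] pops, which is what the two numerical
    hypotheses record. *)
Lemma wt_pops n k i U c S w : valid c S w -> stacks_agree n U S ->
    (k + size S + c.*2 = n.*2)%N -> (i + n = k + c)%N ->
  scan_wt x q n.*2 k U w = oneline_wt i (pops c S w).
Proof.
elim: w k i U c S => [|[] w IH] k i U c S //=.
  case: c => // c vw US eJ eI; apply: IH vw _ _ _ => /=; try lia.
  by split=> //; lia.
case: S U => [|v S] [|a U] //= vw [ea US] eJ eI.
rewrite (IH _ i.+1 _ _ _ vw US); try lia; congr (_ * _).
rewrite /tunnel_wt /entry_wt.
(* The invariants give [a + k + 1 + 2 v = 2 n + 2 i]: the centre of the word separates excedances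
   from the rest. *)
have -> : (a + k + 1 < n.*2)%N = (i < v)%N by apply/idP/idP; lia.
by have -> : (a + k + 1 == n.*2)%N = (i == v) by apply/eqP/eqP; lia.
Qed.

Fixpoint lrmin (m : nat) (t : seq nat) : nat :=
  if t is v :: t' then ((v < m) + lrmin (minn m v) t')%N else 0%N.

(** A value popped right after its push is smaller than all earlier output; one popped after a pop
    exceeds the value just output. The last hypothesis keeps track of this: after a push the top of
    the stack is below the minimum [m] so far, after a pop the whole stack is above it. *)
Lemma peaks_lrmin l m c S w : sorted ltn S -> all (leq c) S -> valid c S w ->
    (c <= m)%N -> (if l then (head m S < m)%N else all (ltn m) S) ->
  peaks l w = lrmin m (pops c S w).
Proof.
elim: w l m c S => [|[] w IH] l m c S //= sS cS.
  case: c cS => // c cS /= vw cm lS; rewrite andbF; apply: IH => //=.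
  - by rewrite (path_sortedE ltn_trans) sS andbT.
  - by rewrite leqnn; apply: sub_all cS => b /ltnW.
  - exact: ltnW.
case: S sS cS => // v S sS /= /andP[cv cS] vw cm.
have vS : all (ltn v) S by move: sS; rewrite /= (path_sortedE ltn_trans) => /andP[].
case: l => [vm|/andP[mv mS]].
  rewrite vm (minn_idPr (ltnW vm)) (IH _ v c S) //; exact: path_sorted sS.
rewrite ltnNge (ltnW mv) (minn_idPl (ltnW mv)) (IH _ m c S) //.
exact: path_sorted sS.
Qed.

Lemma peaks_rcons_true l w : peaks l (rcons w true) = peaks l w.
Proof. by elim: w l => [|b w IH] l; rewrite /= ?andbF ?IH. Qed.

End Dictionary.

(** * Decreasing subsequences and left-to-right minima *)

Section Decreasing.
Local Open Scope nat_scope.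

Fixpoint lrminima (m : nat) (t : seq nat) : seq nat :=
  if t is v :: t' then
    if v < m then v :: lrminima v t' else lrminima m t'
  else [::].

Lemma size_lrminima m t : size (lrminima m t) = lrmin m t.
Proof.
elim: t m => //= v t IH m; case: ltnP => [vm|mv] /=.
  by rewrite IH.
by rewrite IH.
Qed.

Lemma lrminima_path m t : path gtn m (lrminima m t).
Proof.
have step t' m1 m2 : m1 <= m2 -> path gtn m1 (lrminima m1 t') ->
    path gtn m2 (lrminima m1 t').
  case: (lrminima _ _) => //= a s le_m /andP[lt_a ->]; rewrite andbT.
  exact: leq_trans le_m.
elim: t m => //= v t IH m; case: ltnP => [vm|mv] //=.
by rewrite vm IH.
Qed.

Lemma lrminima_subseq m t : subseq (lrminima m t) t.
Proof.
elim: t m => //= v t IH m; case: ltnP => [vm|mv] /=; first by rewrite eqxx IH.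
exact: subseq_trans (IH m) (subseq_cons t v).
Qed.

(** When [v] is a new minimum, 132-avoidance makes the later entries above [v] increase, so a
    decreasing [s] contains at most one of them, and counting [v] compensates for it. *)
Lemma size_below_lrmin m t s : uniq t -> av132 t -> sorted ltn [seq b <- t | m < b] ->
  subseq s t -> sorted gtn s -> size [seq b <- s | b < m] <= lrmin m t.
Proof.
have gtn_trans : transitive gtn by move=> a b c /= ab bc; exact: ltn_trans bc ab.
elim: t m s => [|v t IH] m s /=; first by move=> _ _ _ /eqP->.
case/andP=> vnt Ut /andP[vt av] mt; case: s => //= a s; case: eqP => [->|nav].
  move=> st; rewrite (path_sortedE gtn_trans) => /andP[vs ss].
  have fv : [seq b <- s | b < v] = s by apply/all_filterP.
  case: ltnP => [vm|mv].
    rewrite /= add1n ltnS.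
    apply: leq_trans (IH v s Ut av vt st ss); rewrite fv.
    by rewrite size_filter count_size.
  rewrite add0n; apply: IH => //.
  by move: mt; case: ifP => // _ /path_sorted.
move=> st ss.
have mt' : sorted ltn [seq b <- t | m < b].
  by move: mt; case: ifP => // _ /path_sorted.
case: (ltnP v m) => [vm|mv]; last exact: (IH m (a :: s)).
rewrite -[size _]/(size [seq b <- a :: s | b < m]).
have {}ss : sorted gtn (a :: s) by [].
move: (a :: s) st ss => {nav a}s st ss.
apply: leq_trans (_ : 1 + size [seq b <- s | b < v] <= _); last first.
  by rewrite leq_add2l; exact: IH.
have sub1 : size [seq b <- s | v < b] <= 1.
  have : subseq [seq b <- s | v < b] [seq b <- t | v < b].
    by rewrite subseq_filter filter_all; exact: subseq_trans (filter_subseq _ _) st.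
  move/(subseq_sorted ltn_trans)/(_ vt).
  have := sorted_filter gtn_trans (ltn v) ss.
  case: [seq b <- s | v < b] => [|a [|b r]] //= /andP[ba _] /andP[ab _].
  by move: ba ab => /=; lia.
rewrite !size_filter in sub1 *.
apply: leq_trans (leq_add sub1 (leqnn _)); rewrite -count_predUI.
apply: leq_trans (leq_addr _ _); apply: leq_trans (count_size _ _) _.
rewrite leq_eqVlt eq_sym -all_count; apply/orP; left; apply/allP => b bs /=.
have : b != v by apply: contraNneq vnt => <-; exact: (mem_subseq st).
by lia.
Qed.

(** The minima themselves form a decreasing subsequence, whose prefixes realize the smaller
    lengths. *)
Lemma lrmin_decreasing n t d : uniq t -> av132 t -> all (gtn n) t ->
  (exists s, [/\ subseq s t, sorted gtn s & size s = d]) <-> d <= lrmin n t.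
Proof.
move=> Ut av tn; split=> [[s [st ss <-]]|le_d].
  have fs : [seq b <- s | b < n] = s.
    by apply/all_filterP/allP => b /(mem_subseq st)/(allP tn).
  rewrite -{1}fs; apply: size_below_lrmin => //.
  suff -> : [seq b <- t | n < b] = [::] by [].
  apply/eqP; rewrite -[_ == _]negbK -has_filter; apply/hasPn => b /(allP tn) /=.
  by lia.
exists (take d (lrminima n t)); split.
- exact: subseq_trans (take_subseq _ _) (lrminima_subseq _ _).
- by apply: take_sorted; exact: path_sorted (lrminima_path n t).
- by rewrite size_takel // size_lrminima.
Qed.

End Decreasing.

(** * One-line notation of permutations *)

Section OneLine.
Variable n : nat.
Implicit Types pi : 'S_n.

Definition oneline pi : seq nat := [seq val (pi i) | i <- enum 'I_n].

Lemma size_oneline pi : size (oneline pi) = n.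
Proof. by rewrite size_map size_enum_ord. Qed.

Lemma nth_oneline pi (i : 'I_n) : nth 0%N (oneline pi) i = pi i.
Proof. by rewrite (nth_map i) ?size_enum_ord // nth_ord_enum. Qed.

Lemma oneline_inj : injective oneline.
Proof.
move=> pi1 pi2 e; apply/permP => i; apply: val_inj.
by rewrite /= -!nth_oneline e.
Qed.

Lemma uniq_oneline pi : uniq (oneline pi).
Proof.
rewrite map_inj_uniq ?enum_uniq //.
by apply: inj_comp; [exact: val_inj|exact: perm_inj].
Qed.

Lemma oneline_lt pi : all (gtn n) (oneline pi).
Proof. by apply/allP => _ /mapP[i _ ->] /=. Qed.

Lemma perm_oneline pi : perm_eq (oneline pi) (iota 0 n).
Proof.
have [] := uniq_min_size (uniq_oneline pi) (s2 := iota 0 n).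
- by move=> b /(allP (oneline_lt pi)); rewrite mem_iota.
- by rewrite size_oneline size_iota.
by move=> _ e; apply: uniq_perm; rewrite ?uniq_oneline ?iota_uniq.
Qed.

Lemma oneline_surj t : perm_eq t (iota 0 n) -> exists pi, oneline pi = t.
Proof.
move=> pt; have st : size t = n by rewrite (perm_size pt) size_iota.
have lt_t (i : 'I_n) : (nth 0 t i < n)%N.
  have : nth 0%N t i \in t by rewrite mem_nth ?st.
  by rewrite (perm_mem pt) mem_iota.
have f_inj : injective (fun i : 'I_n => Ordinal (lt_t i)).
  move=> i j [/eqP]; rewrite nth_uniq ?st ?(perm_uniq pt) ?iota_uniq //.
  by move/eqP/val_inj.
exists (perm f_inj); apply: (@eq_from_nth _ 0%N); rewrite size_oneline ?st //.
by move=> i lt_in; rewrite -[i]/(val (Ordinal lt_in)) nth_oneline permE.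
Qed.

Lemma oneline_wtE (R : comNzRingType) (x q : R) pi :
  oneline_wt x q 0 (oneline pi) = x ^+ fp pi * q ^+ exc pi.
Proof.
have gen i t : oneline_wt x q i t =
    \prod_(j < size t) entry_wt x q (i + j) (nth 0%N t j).
  elim: t i => [|v t IH] i /=; first by rewrite big_ord0.
  rewrite big_ord_recl addn0 IH; congr (_ * _).
  by apply: eq_bigr => j _; rewrite addSnnS.
rewrite gen size_oneline; under eq_bigr => j _ do rewrite nth_oneline add0n.
rewrite /fp /exc -!prodr_const [in RHS]big_mkcond [X in _ = _ * X]big_mkcond -big_split.
apply: eq_bigr => j _; rewrite /entry_wt !inE -val_eqE /= eq_sym.
by case: ltngtP; rewrite ?mulr1 ?mul1r.
Qed.

End OneLine.

(** * Pattern containment in terms of subsequences *)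

Section Patterns.
Local Open Scope nat_scope.

Lemma unsortedP (s : seq nat) : uniq s -> ~~ sorted ltn s ->
  exists y z, subseq [:: y; z] s /\ z < y.
Proof.
elim: s => //= y s IH /andP[ys Us]; rewrite (path_sortedE ltn_trans) negb_and.
case: (boolP (all (ltn y) s)) => [_ /= /(IH Us)[y' [z [sub lt_zy]]]|/allPn[z zs]].
  by exists y', z; split=> //; exact: subseq_trans sub (subseq_cons s y).
rewrite -leqNgt => le_zy _; exists y, z; split; first by rewrite /= eqxx sub1seq.
by rewrite ltn_neqAle le_zy andbT; apply: contraNneq ys => <-.
Qed.

Lemma av132P (t : seq nat) : uniq t ->
  ~~ av132 t <-> exists a b c, subseq [:: a; b; c] t /\ a < c < b.
Proof.
elim: t => [|x t IH] /=; first by split=> // -[a [b [c []]]].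
case/andP=> xt Ut; rewrite negb_and; split.
  case/orP=> [/unsortedP|].
    rewrite filter_uniq // => /(_ isT)[b [c []]].
    rewrite subseq_filter /= andbT => /andP[/andP[xb xc] sub] cb.
    by exists x, b, c; rewrite eqxx sub xc cb.
  move/(IH Ut) => [a [b [c [sub lt]]]]; exists a, b, c; split=> //.
  case: eqP => // _; exact: subseq_trans (subseq_cons _ _) sub.
move=> [a [b [c [sub /andP[ac cb]]]]]; apply/orP.
move: sub; case: eqP => [ax sub|_ sub]; last first.
  by right; apply/(IH Ut); exists a, b, c; rewrite sub ac cb.
left; apply/negP => /(subseq_sorted ltn_trans (s1 := [:: b; c])).
rewrite subseq_filter /= -ax ac (ltn_trans ac cb) sub => /(_ isT).
by rewrite andbT ltnNge (ltnW cb).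
Qed.

Variable n : nat.
Implicit Types pi : 'S_n.

Lemma sorted_enum_ord m : sorted (relpre val ltn) (enum 'I_m).
Proof. by rewrite -sorted_map val_enum_ord iota_ltn_sorted. Qed.

Lemma subseq_enum_ord (r : seq 'I_n) :
  sorted (relpre val ltn) r -> subseq r (enum 'I_n).
Proof.
move=> sr; have ltr : transitive (relpre (@nat_of_ord n) ltn).
  by move=> i j k /=; exact: ltn_trans.
suff -> : r = [seq i <- enum 'I_n | i \in r] by exact: filter_subseq.
apply: (irr_sorted_eq ltr) => // [i||i] /=; first exact: ltnn.
- exact/sorted_filter/sorted_enum_ord.
- by rewrite mem_filter mem_enum andbT.
Qed.

Lemma containsP m pi (sigma : 'S_m) : contains pi sigma <->
  exists s, [/\ subseq s (oneline pi), size s = m &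
    forall i j : 'I_m, (nth 0 s i < nth 0 s j) = (sigma i < sigma j)].
Proof.
split=> [/existsP[f /andP[/forallP f_inc /forallP f_pat]]|].
  exists [seq val (pi (f i)) | i <- enum 'I_m]; split.
  - rewrite (map_comp (fun i => val (pi i)) f); apply/map_subseq/subseq_enum_ord.
    apply: homo_sorted (sorted_enum_ord m) => i j ij.
    by move/forallP: (f_inc i) => /(_ j)/implyP; apply.
  - by rewrite size_map size_enum_ord.
  - have nth_s (k : 'I_m) : nth 0 [seq val (pi (f i)) | i <- enum 'I_m] k = pi (f k).
      by rewrite (nth_map k) ?size_enum_ord // nth_ord_enum.
    move=> i j; rewrite !nth_s.
    by move/forallP: (f_pat i) => /(_ j)/eqP.
case=> s [/subseqP[b sb ->]]; rewrite -map_mask => sm s_pat.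
set r := mask b _ in sm s_pat; rewrite size_map in sm.
have sr : sorted (relpre val ltn) r.
  by apply: sorted_mask (sorted_enum_ord n) => i j k /=; exact: ltn_trans.
(* ['I_n] may be empty, so a default element for [nth] is obtained from an index [i]. *)
have x0 (i : 'I_m) : 'I_n := tnth (Tuple (introT eqP sm)) i.
apply/existsP; exists [ffun i => tnth (Tuple (introT eqP sm)) i].
apply/andP; split; apply/forallP => i; apply/forallP => j; rewrite !ffunE.
  apply/implyP => lt_ij; rewrite !(tnth_nth (x0 i)) /=.
  apply: (sorted_ltn_nth (leT := relpre val ltn)) => //; rewrite ?inE ?sm //.
  by move=> ? ? ? /=; exact: ltn_trans.
apply/eqP; rewrite -s_pat !(tnth_nth (x0 i)) /=.
by rewrite !(nth_map (x0 i)) ?sm.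
Qed.

Lemma contains132 pi : contains pi (tagged p132) = ~~ av132 (oneline pi).
Proof.
have val_p132 i : nth 0 [:: 0; 2; 1] (val i) = tagged p132 i :> nat.
  rewrite permE /= -!val_eqE /= !inordK //.
  by case: i => [[|[|[|//]]] lt_i3] //=; rewrite inordK.
apply/idP/idP => [/containsP|/(av132P (uniq_oneline pi))].
  case=> s [sub sz s_pat]; apply/(av132P (uniq_oneline pi)).
  exists (nth 0 s 0), (nth 0 s 1), (nth 0 s 2); split.
    by move: sz sub {s_pat}; case: s => [|a [|b [|c []]]].
  have lt3 i : i < 3 -> i < tag p132 by [].
  have := s_pat (Ordinal (lt3 0 isT)) (Ordinal (lt3 2 isT)).
  have := s_pat (Ordinal (lt3 2 isT)) (Ordinal (lt3 1 isT)).
  by rewrite -!val_p132 /= => -> ->.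
case=> a [b [c [sub /andP[ac cb]]]]; apply/containsP; exists [:: a; b; c]; split=> //.
move=> i j; rewrite -!val_p132.
by case: i j => [[|[|[|//]]] ?] [[|[|[|//]]] ?] /=; lia.
Qed.

Lemma contains_decreasing pi d :
  contains pi (tagged (decreasing_pattern d)) <->
  exists s, [/\ subseq s (oneline pi), sorted gtn s & size s = d].
Proof.
split=> [/containsP[s [sub sz s_pat]]|[s [sub ss <-]]].
  have {}sz : size s = d := sz.
  have {}s_pat (i j : 'I_d) : (nth 0 s i < nth 0 s j) = (rev_ord i < rev_ord j).
    by rewrite s_pat !permE.
  exists s; split=> //; apply/(sortedP 0) => i; rewrite sz => lt_i.
  by rewrite /= (s_pat (Ordinal lt_i) (Ordinal (ltnW lt_i))) /=; lia.
apply/containsP; exists s; split=> // i j; rewrite !permE /=.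
have gtn_trans : transitive gtn by move=> a b c /= ab bc; exact: ltn_trans bc ab.
have dec := sorted_ltn_nth gtn_trans 0 ss; rewrite /= in dec.
have [lt_i lt_j] : i < size s /\ j < size s by split; exact: ltn_ord.
case: (ltngtP (i : nat) (j : nat)) => [lt_ij|lt_ji|->]; last by rewrite !ltnn.
  have /= lt_ji := dec _ _ lt_i lt_j lt_ij.
  by rewrite ltnNge (ltnW lt_ji) ltnNge leq_sub2l // ltnW.
by rewrite (dec _ _ lt_j lt_i lt_ji); exact/esym/(ltn_sub2l (leq_ltn_trans lt_ji lt_i)).
Qed.

End Patterns.

(** * From pattern-avoiding permutations to sums over words *)

Lemma mem_Sav132 n (pi : 'S_n) : (pi \in Sav n [:: p132]) = av132 (oneline pi).
Proof. by rewrite inE /= andbT /avoids contains132 negbK. Qed.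

Lemma perm_oneline_pops n :
  perm_eq [seq oneline pi | pi <- enum (Sav n [:: p132])]
          [seq pops n [::] w | w <- ewords n & valid n [::] w].
Proof.
apply: uniq_perm => [||t].
- by rewrite map_inj_uniq ?enum_uniq //; exact: oneline_inj.
- rewrite map_inj_in_uniq ?filter_uniq ?uniq_ewords // => w1 w2.
  rewrite !mem_filter => /andP[v1 _] /andP[v2 _].
  exact: (pops_inj (S := [::])).
apply/mapP/mapP => [[pi]|[w]].
  rewrite mem_enum mem_Sav132 => av ->.
  have [||||w [sw vw pw]] := @pops_surj n [::] (oneline pi) _ _ _ av => //.
  - by rewrite cats0 perm_oneline.
  - apply/eqP; rewrite -[_ == _]negbK -has_filter; apply/hasPn => b.
    by move/(allP (oneline_lt pi)) => /=; lia.
  exists w; rewrite ?pw // mem_filter vw mem_ewords sw size_oneline; lia.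
rewrite mem_filter => /andP[vw _] ->.
have [//|//|pw av _] := valid_pops (S := [::]) _ _ vw.
rewrite cats0 in pw; have [pi e] := oneline_surj pw.
by exists pi; rewrite // mem_enum mem_Sav132 e.
Qed.

(** The context [false], [true] makes no peak at either end, and [kron] at [(0, 0)] selects the
    valid words. *)
Lemma sum_Sav132 (R : comNzRingType) (x q p : R) n :
  \sum_(pi in Sav n [:: p132])
    x ^+ fp pi * q ^+ exc pi * p ^+ lrmin n (oneline pi) =
  word_sum x q p n 0 0 false true.
Proof.
under eq_bigr => pi _ do rewrite -oneline_wtE.
rewrite -big_enum -(big_map _ xpredT (fun t => oneline_wt x q 0 t * p ^+ lrmin n t)).
rewrite (perm_big _ (perm_oneline_pops n)) big_map big_filter big_mkcond.
apply: eq_big_seq => w wn; rewrite /kron -(valid_ewords wn) peaks_rcons_true.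
case: ifP => vw; last by rewrite mulr0.
have /eqP sw : size w == n.*2 by rewrite -mem_ewords.
rewrite mulr1 mulrC /word_wt sw (wt_pops _ _ vw (n := n) (i := 0)) //.
by rewrite (peaks_lrmin (m := n) _ _ vw).
Qed.

Lemma mem_Sav132_decreasing n k (pi : 'S_n) :
  (pi \in Sav n [:: p132; decreasing_pattern k.+1]) =
  (pi \in Sav n [:: p132]) && (lrmin n (oneline pi) <= k)%N.
Proof.
rewrite mem_Sav132 inE /= andbT {1}/avoids contains132 negbK.
case: (boolP (av132 _)) => //= av; rewrite /avoids leqNgt; congr (~~ _).
apply/idP/idP => [/contains_decreasing|].
  by move/(lrmin_decreasing _ (uniq_oneline pi) av (oneline_lt pi)).
by move/(lrmin_decreasing _ (uniq_oneline pi) av (oneline_lt pi))/contains_decreasing.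
Qed.

(** Multiplication by [1 - p] takes differences in [k], turning the condition [lrmin <= k] into
    [lrmin = k], that is, into the weight [p ^+ lrmin]. *)
Lemma sub1p_F :
  (1 - p_) * (\fps_k F [:: p132; decreasing_pattern k.+1] : Qxqzp) =
  motz_series xvar qvar 0 CD.
Proof.
rewrite /motz_series; under eq_swap_zp => n.
  rewrite -(word_sum_motz _ _ _ n false true (i := 0) (j := 0)) // -sum_Sav132.
  over.
apply: coefs2P => k n; rewrite mulrBl mul1r !coefsD !coefsN coefs_fpsXM.
have -> : coefs (coefs (swap_zp (fun n => \sum_(pi in Sav n [:: p132])
    xvar%:S ^+ fp pi * qvar%:S ^+ exc pi
    * (fpsX : {fps Qxq}) ^+ lrmin n (oneline pi))) k) n =
  \sum_(pi in Sav n [:: p132])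
    xvar ^+ fp pi * qvar ^+ exc pi * (lrmin n (oneline pi) == k)%:R.
  have fpsCX (c : Qxq) m : c%:S ^+ m = (c ^+ m)%:S.
    elim: m => [|m IH]; first by apply: fpsP.
    rewrite !exprS IH; apply: fpsP => i; rewrite coefsCM /=.
    by case: i => //=; rewrite mulr0.
  rewrite /= coefs_sum; apply: eq_bigr => pi _.
  by rewrite !fpsCX -mulrA !coefsCM coefsXn eq_sym mulrA.
rewrite /=; under eq_bigl => pi do rewrite mem_Sav132_decreasing.
rewrite big_mkcondr /=.
case: k => [|k].
  rewrite oppr0 addr0; apply: eq_bigr => pi _.
  by rewrite leqn0; case: eqP; rewrite ?mulr1 ?mulr0.
under [X in _ - X]eq_bigl => pi do rewrite mem_Sav132_decreasing.
rewrite big_mkcondr /= -sumrB; apply: eq_bigr => pi _.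
rewrite leq_eqVlt ltnS; case: eqP => [->|_] /=.
  by rewrite ltnn subr0 mulr1.
by case: ifP; rewrite ?subrr ?subr0 mulr0.
Qed.

(** * Closed form of the series *)

Lemma constant_terms (R T : comNzRingType) (c : R -> T) (q z k E : R) :
    {morph c : f g / f + g} -> {morph c : f / - f} -> {morph c : f g / f * g} ->
    c 1 = 1 -> c z = 0 -> c E = 0 ->
  c (1 - (1 + q) * z + q * z ^+ 2 * k ^+ 2 - E) = 1 /\
  c ((1 - q * z ^+ 2 * k ^+ 2) * (1 - E) - (1 + q) * z - 2 * q * z ^+ 2 * k) = 1.
Proof.
move=> cD cN cM c1 cz cE; rewrite !(cD, cN, cM, exprS) cz c1 cE.
by rewrite !(mulr0, mul0r, oppr0, addr0, mulr1).
Qed.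

(** At height 0 the contexts D and F differ only in the base value, 1 against [p]. Hence
    [MF = G + p - 1], and the recursion at height 0 becomes linear in [G]. *)
Lemma motz_series_closed E : let x := x_ in let q := q_ in let z := z_ in let p := p_ in
  let k := p - 1 in
  let m := 1 - (1 + q) * z + q * z ^+ 2 * k ^+ 2 - E in
  E * m = p ^+ 2 * q * z ^+ 2 -> coefs (coefs E 0) 0 = 0 ->
  motz_series xvar qvar 0 CD * (1 - E - x * z) = 1 + x * z * (p - 1).
Proof.
move=> x q z p k m Em E0.
(* The denominators [m] and [B] of [descent_solution] have constant term 1, so they are units. *)
have [||||c1 c2] := @constant_terms _ _ (fun f : Qxqzp => coefs (coefs f 0) 0)
  q z k E _ _ _ (coefs1 _ 0) _ E0 => //; first by move=> f g; rewrite !coefs0M.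
have [||Y Ysys YE] := descent_solution Em.
- by rewrite !fps_unitE c1 unitr1.
- by rewrite !fps_unitE c2 unitr1.
set G := motz_series _ _ 0 CD; pose M2 := motz_series xvar qvar 2 CU.
pose MF := motz_series xvar qvar 0 CF.
have eU : M2 = Y CU * G := motz_series_descent xvar 0 CU Ysys.
have eD : G = 1 + z * (q * M2 + x * MF) := motz_series0 xvar qvar CD.
have eF : MF = p + z * (q * M2 + x * MF) := motz_series0 xvar qvar CF.
clearbody G M2 MF x q z p.
have {}eF : MF = G + p - 1 by rewrite eF eD; ring.
rewrite -YE; rewrite eF eU in eD.
by rewrite mulrBr mulrBr mulr1 {1}eD; ring.
Qed.

(** [f1] is the discriminant of the quadratic equation for [E = 1 - D]; four times the difference of
    the two sides is [f1 - S ^+ 2]. *)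
Lemma quadratic_from_sqrt (R : comUnitRingType) (q z p S D : R) :
    (2 : R) \is a GRing.unit -> S ^+ 2 = f1 q z p ->
    D * 2 = 1 + (1 + q) * z - q * z ^+ 2 * (p - 1) ^+ 2 + S ->
  (1 - D) * (1 - (1 + q) * z + q * z ^+ 2 * (p - 1) ^+ 2 - (1 - D)) =
  p ^+ 2 * q * z ^+ 2.
Proof.
move=> U2 S2 D2; apply: (mulIr (unitrX 2 U2)); apply/eqP; rewrite -subr_eq0.
have eS : S = D * 2 - (1 + (1 + q) * z - q * z ^+ 2 * (p - 1) ^+ 2).
  by rewrite D2; ring.
apply/eqP; transitivity (f1 q z p - S ^+ 2); last by rewrite S2 subrr.
by rewrite eS /f1; ring.
Qed.

Lemma constant_term_sum (R T : comNzRingType) (c : R -> T) (q z k S : R) :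
    {morph c : f g / f + g} -> {morph c : f / - f} -> {morph c : f g / f * g} ->
    c 1 = 1 -> c z = 0 ->
  c (1 + (1 + q) * z - q * z ^+ 2 * k ^+ 2 + S) = 1 + c S.
Proof.
move=> cD cN cM c1 cz; rewrite !(cD, cN, cM, exprS) cz c1.
by rewrite !(mulr0, mul0r, oppr0, addr0).
Qed.

Theorem theorem4p11 :
  let x := x_ in let q := q_ in let z := z_ in let p := p_ in
  (\fps_k F [:: p132; decreasing_pattern k.+1] : Qxqzp) =
  2 * (1 + x * z * (p - 1))
    / ((1 - p) * (1 + (1 + q - 2 * x) * z - q * z ^+ 2 * (p - 1) ^+ 2
                  + fps2_sqrt (f1 q z p))).
Proof.
move=> x q z p.
have S2 := sqr_sqrt_f1; have S0 := coefs00_fps2_sqrt (f1 q z p).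
have U := denominator_unit; apply: (canRL (mulrK U)).
move: (fps2_sqrt _) S2 S0 {U} => S S2 S0.
have U2 : (2 : Qxq) \is a GRing.unit.
  have -> : 2 = (2 : rat)%:P%:P :> Qxq by rewrite !rmorph_nat.
  by rewrite poly_unitE size_polyC !coefC /= polyC_eq0 poly_unitE size_polyC coefC.
have c2 : coefs (coefs (2 : Qxqzp) 0) 0 = 2 by [].
have U2' : (2 : Qxqzp) \is a GRing.unit by rewrite !fps_unitE c2.
(* [1 - D] is the root with constant term 0, because [S] has constant term 1. *)
pose D := (1 + (1 + q) * z - q * z ^+ 2 * (p - 1) ^+ 2 + S) / 2.
have D2 : D * 2 = 1 + (1 + q) * z - q * z ^+ 2 * (p - 1) ^+ 2 + S by rewrite divrK.
have D0 : coefs (coefs D 0) 0 = 1.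
  have c0M (f g : Qxqzp) : coefs (coefs (f * g) 0) 0
      = coefs (coefs f 0) 0 * coefs (coefs g 0) 0 by rewrite !coefs0M.
  have cS := @constant_term_sum _ _ (fun f : Qxqzp => coefs (coefs f 0) 0)
    q z (p - 1) S (fun _ _ => erefl) (fun _ => erefl) c0M (coefs1 _ 0) erefl.
  apply: (mulIr U2); rewrite mul1r -[RHS]/(1 + 1) -[X in 1 + X]S0 -cS -D2.
  exact: esym (c0M D 2).
have Em := quadratic_from_sqrt U2' S2 D2.
have E0 : coefs (coefs (1 - D) 0) 0 = 0.
  by rewrite !(coefsD, coefsN) D0 subrr.
have G := motz_series_closed Em E0.
rewrite -sub1p_F -/p in G.
move: (\fps_k _) G => L G; rewrite -/x -/q -/z -/p in G *.
clearbody D x q z p.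
rewrite -G.
(* In terms of [D] the bracket in the denominator is [2 * (D - x * z)], twice the factor
   [1 - E - x * z] at [E = 1 - D]. *)
have -> : S = D * 2 - (1 + (1 + q) * z - q * z ^+ 2 * (p - 1) ^+ 2).
  by rewrite D2; ring.
ring.
Qed.
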